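(* Let $a\ge 0$, $b>0$ be real numbers with $0<1-b+a<1$, and let $\beta$ be a real number. Then the function $$g_{\beta}(x)=\frac{(x+a)^{\beta}\,\Gamma(x+a)}{\Gamma(x+b)}$$ is logarithmically completely monotone on $(-a,\infty)$ if and only if $\beta\le b-a$.
   Context: A positive function $f:I\to\mathbb{R}$ on an interval $I\subseteq\mathbb{R}$ is called logarithmically completely monotone if it has derivatives of all orders and $(-1)^n(\log\circ f)^{(n)}(x)\ge 0$ for all $n=1,2,\ldots$ and all $x\in I$. $\Gamma$ is the Gamma function. *)

(* Defs.v *)
From Stdlib Require Import Reals.
From Coquelicot Require Import Coquelicot.
Open Scope R_scope.

(* Euler's integral, improper at both ends (integral over (0,+oo) of
   t^(x-1) e^(-t) dt).  It converges exactly when 0 < x; for x <= 0 the value of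
   [Gamma x] is unspecified. *)
Definition Gamma (x : R) : R :=
  RInt_gen (fun t : R => Rpower t (x - 1) * exp (- t))
           (at_right 0) (Rbar_locally p_infty).

(* Only open intervals (l,u), possibly unbounded, are covered: the derivatives
   below are two-sided, and depend on the total function f only through its
   restriction to (l,u). *)
Definition log_completely_monotone (l u : Rbar) (f : R -> R) : Prop :=
  (forall x : R, Rbar_lt l x -> Rbar_lt x u -> 0 < f x) /\
  (forall (n : nat) (x : R), Rbar_lt l x -> Rbar_lt x u -> ex_derive_n f n x) /\
  (forall (n : nat) (x : R), (1 <= n)%nat -> Rbar_lt l x -> Rbar_lt x u ->
     0 <= (-1) ^ n * Derive_n (fun y : R => ln (f y)) n x).

(* Main.v *)
(* With s = b - a and y = x + a, the function h(y) = ln Gamma(y) - ln Gamma(y + s) + s ln y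
   satisfies 0 <= h(y) <= 1/y (Wendel's inequality) and, by the functional equation,
   h(y) - h(y + 1) = ln(y + s) - (1 - s) ln y - s ln(y + 1), so h is the sum over k of the
   convexity gaps of - ln at y + k.  The derivatives of - ln are, up to the sign (-1)^n, again
   convex, and their gaps are dominated by a telescoping series, so that h can be differentiated
   termwise and (-1)^n h^(n) >= 0.  As ln g = h + (beta - s) ln y, this gives sufficiency;
   conversely, since h >= 0, ln g can only be decreasing if beta <= s. *)
Require Import Defs.
From Stdlib Require Import Reals Lra Factorial.
From Coquelicot Require Import Coquelicot.
Open Scope R_scope.

(** * Convergence and positivity of Euler's integral *)

Lemma is_derive_Rpower (x t : R) (ht : 0 < t) :
  is_derive (fun u => Rpower u x) t (x * Rpower t (x - 1)).
Proof.
  apply is_derive_Reals.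
  now apply derivable_pt_lim_power.
Qed.

(** For a nonnegative integrand the integral grows with the interval, so the supremum over compact
    intervals is the improper integral. The second conjunct later yields positivity of [Gamma]. *)
Lemma is_RInt_gen_nonneg_lub (f : R -> R) (M : R)
    (fcont : forall t, 0 < t -> continuous f t) (fpos : forall t, 0 < t -> 0 <= f t)
    (fbound : forall p q, 0 < p -> p <= q -> RInt f p q <= M) :
  exists l, is_RInt_gen f (at_right 0) (Rbar_locally p_infty) l /\
    forall p q, 0 < p -> p <= q -> RInt f p q <= l.
Proof.
  assert (fint : forall p q, 0 < p -> p <= q -> ex_RInt f p q).
  { intros p q hp hpq. apply (ex_RInt_continuous (V := R_CompleteNormedModule)).
    intros z hz. apply fcont. rewrite Rmin_left in hz; lra. }
  destruct (completeness (fun v => exists p q, 0 < p /\ p <= q /\ v = RInt f p q))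
    as [l [hub hlub]].
  - exists M. intros v (p & q & hp & hpq & ->). now apply fbound.
  - exists (RInt f 1 1), 1, 1. repeat split; lra.
  - assert (hle : forall p q, 0 < p -> p <= q -> RInt f p q <= l).
    { intros p q hp hpq. apply hub. now exists p, q. }
    exists l. split; [| exact hle].
    intros P [eps heps].
    assert (hex : exists p q, 0 < p /\ p <= q /\ l - eps < RInt f p q).
    { apply Classical_Prop.NNPP. intros hn.
      assert (l <= l - eps); [| destruct eps; simpl in *; lra].
      apply hlub. intros v (p & q & hp & hpq & ->).
      apply Rnot_lt_le. intros hlt. apply hn. now exists p, q. }
    destruct hex as (p0 & q0 & hp0 & hpq0 & hlt).
    (* For such [p] and [q] the interval from [p] to [q] contains the one from [p0] to [q0], so its
       integral lies between [l - eps] and [l]. *)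
    exists (fun p => 0 < p < p0) (fun q => q0 < q).
    + exists (mkposreal p0 hp0). intros y hy hy0. split; [exact hy0|].
      apply Rabs_lt_between in hy. unfold minus, plus, opp in hy; simpl in hy. lra.
    + now exists q0.
    + intros p q hp hq. simpl. exists (RInt f p q). split.
      * apply (RInt_correct (V := R_CompleteNormedModule)). apply fint; lra.
      * apply heps.
        assert (h1 : RInt f p q = RInt f p p0 + RInt f p0 q0 + RInt f q0 q).
        { rewrite <- (RInt_Chasles f p p0 q), <- (RInt_Chasles f p0 q0 q);
            try (apply fint; lra). unfold plus; simpl. ring. }
        assert (0 <= RInt f p p0) by
          (apply RInt_ge_0; [lra | apply fint; lra | intros; apply fpos; lra]).
        assert (0 <= RInt f q0 q) by
          (apply RInt_ge_0; [lra | apply fint; lra | intros; apply fpos; lra]).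
        assert (RInt f p q <= l) by (apply hle; lra).
        apply Rabs_lt_between. unfold minus, plus, opp; simpl. destruct eps; simpl in *; lra.
Qed.

Definition gamma_integrand (x t : R) : R := Rpower t (x - 1) * exp (- t).

Lemma gamma_integrand_continuous (x t : R) (ht : 0 < t) :
  continuous (gamma_integrand x) t.
Proof.
  apply (ex_derive_continuous (V := R_NormedModule)).
  unfold gamma_integrand.
  apply (ex_derive_mult (fun t => Rpower t (x - 1)) (fun t => exp (- t))).
  - eexists. now apply is_derive_Rpower.
  - now auto_derive.
Qed.

Lemma gamma_integrand_pos (x t : R) : 0 < gamma_integrand x t.
Proof. apply Rmult_lt_0_compat; apply exp_pos. Qed.

Lemma ln_le_sub_1 (t : R) (ht : 0 < t) : ln t <= t - 1.
Proof.
  pose proof (exp_ineq1_le (ln t)) as H. rewrite exp_ln in H; lra.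
Qed.

(** This is [ln u <= u - 1] at [u = (1 + t) / p], multiplied by [p]. The constant is the maximum of
    [(1 + t)^p e^(-t)] over [t > -1], attained at [1 + t = p]. *)
Lemma exp_opp_le_Rpower (p t : R) (hp : 0 < p) (ht : 0 <= t) :
  exp (- t) <= exp (1 - p + p * ln p) * Rpower (1 + t) (- p).
Proof.
  unfold Rpower. rewrite <- exp_plus.
  assert (H : ln ((1 + t) / p) <= (1 + t) / p - 1)
    by (apply ln_le_sub_1, Rdiv_lt_0_compat; lra).
  rewrite ln_div in H by lra.
  apply (Rmult_le_compat_l p) in H; [| lra].
  replace (p * ((1 + t) / p - 1)) with (1 + t - p) in H by (field; lra).
  assert (Hle : - t <= 1 - p + p * ln p + - p * ln (1 + t)) by lra.
  destruct Hle as [Hlt | Heq]; [left; now apply exp_increasing | right; now f_equal].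
Qed.

(** Taking exponent [x + 1] in [exp_opp_le_Rpower] gives a majorant with an elementary primitive:
    with [u = t / (1 + t)] it is [K u^(x-1) u'], whose primitive [(K / x) u^x] stays below [K / x].
    One majorant thus serves both ends of the integral. *)
Lemma gamma_integral_bound (x p q : R) (hx : 0 < x) (hp : 0 < p) (hpq : p <= q) :
  RInt (gamma_integrand x) p q <= exp (1 - (x + 1) + (x + 1) * ln (x + 1)) / x.
Proof.
  set (K := exp _).
  assert (HK : 0 < K) by apply exp_pos.
  set (g := fun t => K / x * (x * Rpower (t / (1 + t)) (x - 1) * / (1 + t) ^ 2)).
  assert (Hg : is_RInt g p q
     (K / x * Rpower (q / (1 + q)) x - K / x * Rpower (p / (1 + p)) x)).
  { apply (is_RInt_derive (V := R_CompleteNormedModule)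
             (fun t => K / x * Rpower (t / (1 + t)) x)).
    - intros t ht. rewrite Rmin_left in ht by lra.
      apply (is_derive_scal (fun t => Rpower (t / (1 + t)) x)).
      replace (x * Rpower (t / (1 + t)) (x - 1) * / (1 + t) ^ 2)
        with (scal (/ (1 + t) ^ 2) (x * Rpower (t / (1 + t)) (x - 1)))
        by (unfold scal; simpl; unfold mult; simpl; ring).
      apply (is_derive_comp (fun u => Rpower u x) (fun t => t / (1 + t))).
      + apply is_derive_Rpower. apply Rdiv_lt_0_compat; lra.
      + auto_derive; [lra | field; lra].
    - intros t ht. rewrite Rmin_left in ht by lra.
      apply (ex_derive_continuous (V := R_NormedModule)).
      unfold g, Rpower. auto_derive.
      repeat split; try lra. apply Rdiv_lt_0_compat; lra. 
      apply Rgt_not_eq; apply Rmult_lt_0_compat; lra. }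
  assert (Hb : forall t, 0 < t -> Rpower (t / (1 + t)) x <= 1).
  { intros t ht. apply Rle_trans with (exp 0); [| right; apply exp_0]. unfold Rpower.
    assert (x * ln (t / (1 + t)) < 0); [| left; now apply exp_increasing].
    assert (ln (t / (1 + t)) < 0).
    { rewrite <- ln_1. apply ln_increasing; [apply Rdiv_lt_0_compat; lra |].
      apply Rlt_div_l; lra. }
    nra. }
  apply Rle_trans with (RInt g p q).
  - apply RInt_le; [lra | | now eexists; apply Hg |].
    + apply (ex_RInt_continuous (V := R_CompleteNormedModule)).
      intros z hz. apply gamma_integrand_continuous. rewrite Rmin_left in hz; lra.
    + intros t ht. unfold gamma_integrand, g.
      replace (K / x * (x * Rpower (t / (1 + t)) (x - 1) * / (1 + t) ^ 2))
        with (Rpower t (x - 1) * (K * Rpower (1 + t) (- (x + 1)))).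
      * apply Rmult_le_compat_l; [left; apply exp_pos |].
        apply exp_opp_le_Rpower; lra.
      * replace (/ (1 + t) ^ 2) with (Rpower (1 + t) (- (2))).
        -- unfold Rpower. rewrite ln_div by lra.
           replace ((x - 1) * (ln t - ln (1 + t)))
             with ((x - 1) * ln t + - (x - 1) * ln (1 + t)) by ring.
           replace (- (x + 1) * ln (1 + t))
             with (- (x - 1) * ln (1 + t) + - (2) * ln (1 + t)) by ring.
           rewrite !exp_plus. field. lra.
        -- rewrite Rpower_Ropp. f_equal.
           rewrite <- (Rpower_pow 2) by lra; f_equal; simpl; lra.
  - rewrite (is_RInt_unique _ _ _ _ Hg).
    assert (0 < K / x) by now apply Rdiv_lt_0_compat.
    assert (Rpower (q / (1 + q)) x <= 1) by (apply Hb; lra).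
    assert (0 < Rpower (p / (1 + p)) x) by apply exp_pos.
    nra.
Qed.

Lemma Gamma_correct (x : R) (hx : 0 < x) :
  is_RInt_gen (gamma_integrand x) (at_right 0) (Rbar_locally p_infty) (Gamma x)
  /\ 0 < Gamma x.
Proof.
  destruct (is_RInt_gen_nonneg_lub (gamma_integrand x) _
    (fun t => gamma_integrand_continuous x t)
    (fun t _ => Rlt_le _ _ (gamma_integrand_pos x t))
    (fun p q => gamma_integral_bound x p q hx)) as [l [Hl Hle]].
  assert (Hu : Gamma x = l).
  { exact (is_RInt_gen_unique (V := R_CompleteNormedModule) (gamma_integrand x) l Hl). }
  rewrite Hu. split; [exact Hl |].
  apply Rlt_le_trans with (RInt (gamma_integrand x) 1 2); [| apply Hle; lra].
  apply RInt_gt_0; [lra | intros; apply gamma_integrand_pos |].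
  intros t ht. apply gamma_integrand_continuous; lra.
Qed.

(** * Functional equation of Gamma and the upper bound on Gamma(x + s) *)

Lemma filter_prod_pos :
  filter_prod (at_right 0) (Rbar_locally p_infty) (fun ab => 0 < fst ab <= snd ab).
Proof.
  exists (fun p => 0 < p < 1) (fun q => 1 < q).
  - exists (mkposreal 1 Rlt_0_1). intros y hy hy0.
    apply Rabs_lt_between in hy. unfold minus, plus, opp in hy; simpl in hy. lra.
  - now exists 1.
  - simpl. intros; lra.
Qed.

(** Integration by parts: the derivative of [F t = t^x e^(-t)] has improper integral 0, since [F]
    vanishes at both ends, and also [x * Gamma x - Gamma (x + 1)]. Uniqueness of the integral
    equates the two. *)
Lemma Gamma_succ (x : R) (hx : 0 < x) : Gamma (x + 1) = x * Gamma x.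
Proof.
  destruct (Gamma_correct x hx) as [H0 _].
  destruct (Gamma_correct (x + 1)) as [H1 _]; [lra |].
  set (F := fun t => Rpower t x * exp (- t)).
  assert (HF : forall t, 0 < t ->
    is_derive F t (x * gamma_integrand x t - gamma_integrand (x + 1) t)).
  { intros t ht. unfold F, gamma_integrand.
    replace (x + 1 - 1) with x by ring.
    replace (x * (Rpower t (x - 1) * exp (- t)) - Rpower t x * exp (- t))
      with (x * Rpower t (x - 1) * exp (- t) + Rpower t x * - exp (- t)) by ring.
    apply (is_derive_mult (fun t => Rpower t x) (fun t => exp (- t))).
    - now apply is_derive_Rpower.
    - auto_derive; [easy | ring].
    - intros; apply Rmult_comm. }
  assert (HD : is_RInt_gen (Derive F) (at_right 0) (Rbar_locally p_infty) (0 - 0)).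
  { apply is_RInt_gen_Derive.
    - eapply filter_imp; [| exact filter_prod_pos].
      intros [p q] hpq t ht; simpl in *. rewrite Rmin_left in ht by lra.
      eexists; apply HF; lra.
    - eapply filter_imp; [| exact filter_prod_pos].
      intros [p q] hpq t ht; simpl in *. rewrite Rmin_left in ht by lra.
      assert (ht' : 0 < t) by lra.
      apply (continuous_ext_loc _
        (fun t => x * gamma_integrand x t - gamma_integrand (x + 1) t)).
      + exists (mkposreal t ht'). intros y hy. symmetry; apply is_derive_unique, HF.
        apply Rabs_lt_between in hy. unfold minus, plus, opp in hy; simpl in hy. lra.
      + apply (continuous_minus (fun t => x * gamma_integrand x t)).
        * apply (continuous_scal_r (V := R_NormedModule) x).
          now apply gamma_integrand_continuous.
        * now apply gamma_integrand_continuous.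
    - intros P [eps heps].
      (* Near 0, [F t < t^x], so [t < eps^(1/x)] suffices. *)
      exists (mkposreal (Rpower eps (/ x)) (exp_pos _)). intros t ht ht0.
      apply Rabs_lt_between in ht. unfold minus, plus, opp in ht; simpl in ht.
      apply heps. apply Rabs_lt_between. unfold minus, plus, opp; simpl.
      assert (F t < eps).
      { apply Rle_lt_trans with (Rpower t x).
        - unfold F. rewrite <- (Rmult_1_r (Rpower t x)) at 2.
          apply Rmult_le_compat_l; [left; apply exp_pos |].
          rewrite <- exp_0. left; apply exp_increasing; lra.
        - replace (pos eps) with (Rpower (Rpower eps (/ x)) x).
          + apply exp_increasing. apply Rmult_lt_compat_l; [lra |].
            apply ln_increasing; lra.
          + rewrite Rpower_mult. replace (/ x * x) with 1 by (field; lra).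
            apply Rpower_1, cond_pos. }
      assert (0 < F t) by (apply Rmult_lt_0_compat; apply exp_pos).
      destruct eps; simpl in *; lra.
    - intros P [eps heps].
      set (K := exp (1 - (x + 1) + (x + 1) * ln (x + 1))).
      assert (HK : 0 < K) by apply exp_pos.
      (* The exponential bound with exponent [x + 1] gives [F t <= K / (1 + t)], so [t > K / eps]
         suffices; the maximum with 0 makes [t] positive. *)
      exists (Rmax 0 (K / eps)). intros t ht.
      pose proof (Rmax_l 0 (K / eps)). pose proof (Rmax_r 0 (K / eps)).
      apply heps. apply Rabs_lt_between. unfold minus, plus, opp; simpl.
      assert (F t < eps).
      { apply Rle_lt_trans with (K / (1 + t)).
        - apply Rle_trans with (Rpower (1 + t) x * (K * Rpower (1 + t) (- (x + 1)))).
          + apply Rmult_le_compat; try (left; apply exp_pos).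
            * apply Rle_Rpower_l; lra.
            * apply exp_opp_le_Rpower; lra.
          + right. replace (- (x + 1)) with (- x + - (1)) by ring.
            rewrite Rpower_plus, !Rpower_Ropp, Rpower_1 by lra.
            field. split; [lra | apply Rgt_not_eq, exp_pos].
        - apply Rlt_div_l; [lra |].
          assert (K < t * eps); [| destruct eps; simpl in *; lra].
          apply Rlt_div_l; [apply cond_pos | lra]. }
      assert (0 < F t) by (apply Rmult_lt_0_compat; apply exp_pos).
      destruct eps; simpl in *; lra. }
  assert (HE : is_RInt_gen (Derive F) (at_right 0) (Rbar_locally p_infty)
     (x * Gamma x - Gamma (x + 1))).
  { apply (is_RInt_gen_ext
      (fun t => minus (scal x (gamma_integrand x t)) (gamma_integrand (x + 1) t))).
    - eapply filter_imp; [| exact filter_prod_pos].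
      intros [p q] hpq t ht; simpl in *. rewrite Rmin_left in ht by lra.
      symmetry; apply is_derive_unique, HF; lra.
    - apply (is_RInt_gen_minus (V := R_NormedModule)); [| exact H1].
      now apply (is_RInt_gen_scal (V := R_NormedModule)). }
  pose proof (is_RInt_gen_unique (V := R_CompleteNormedModule) _ _ HD) as E1.
  pose proof (is_RInt_gen_unique (V := R_CompleteNormedModule) _ _ HE) as E2.
  rewrite E1 in E2. unfold minus, plus, opp, zero in E2; simpl in E2. lra.
Qed.

(* Weighted AM-GM [(t/x)^s <= 1 - s + s t/x] under the integral; the choice of
   [x] as comparison point is what makes the two resulting Gamma terms combine. *)
Lemma Gamma_add_le (x s : R) (hx : 0 < x) (hs : 0 < s < 1) :
  Gamma (x + s) <= Rpower x s * Gamma x.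
Proof.
  destruct (Gamma_correct x hx) as [H0 _].
  destruct (Gamma_correct (x + 1)) as [H1 _]; [lra |].
  destruct (Gamma_correct (x + s)) as [Hs Hpos]; [lra |].
  set (c := Rpower x s).
  pose proof (is_RInt_gen_plus _ _ _ _
    (is_RInt_gen_scal _ (c * (1 - s)) _ H0) (is_RInt_gen_scal _ (c * s / x) _ H1)) as HG.
  replace (c * Gamma x)
    with (plus (scal (c * (1 - s)) (Gamma x)) (scal (c * s / x) (Gamma (x + 1)))).
  2:{ unfold plus, scal; simpl; unfold mult; simpl. rewrite Gamma_succ by lra. field; lra. }
  apply Rle_trans with (Rabs (Gamma (x + s))); [apply Rle_abs |].
  (* Monotonicity of the improper integral, obtained from the norm inequality because the left
     integrand is positive and equals its own norm. *)
  refine (RInt_gen_norm (V := R_CompleteNormedModule) _ _ _ _ _ _ Hs HG).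
  - eapply filter_imp; [| exact filter_prod_pos]. intros [p q]; simpl; lra.
  - eapply filter_imp; [| exact filter_prod_pos].
    intros [p q] hpq t ht; simpl in *.
    unfold norm; simpl. unfold abs; simpl.
    rewrite Rabs_right by (apply Rle_ge; left; apply gamma_integrand_pos).
    unfold plus, scal; simpl; unfold mult; simpl. unfold gamma_integrand.
    assert (ht0 : 0 < t) by lra.
    replace (x + s - 1) with ((x - 1) + s) by ring.
    replace (x + 1 - 1) with ((x - 1) + 1) by ring.
    rewrite !Rpower_plus, Rpower_1 by lra.
    set (A := Rpower t (x - 1)). set (B := exp (- t)).
    assert (HA : 0 < A * B) by (apply Rmult_lt_0_compat; apply exp_pos).
    assert (Hy : Rpower t s <= c * (1 - s + s * (t / x))).
    { replace t with (x * (t / x)) at 1 by (field; lra).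
      assert (hr : 0 < t / x) by now apply Rdiv_lt_0_compat.
      rewrite <- Rpower_mult_distr by lra.
      apply Rmult_le_compat_l; [left; apply exp_pos |].
      set (r := t / x) in *. set (w := 1 - s + s * r).
      assert (hw : 0 < w) by (unfold w; nra).
      replace w with (exp (ln w)) by now apply exp_ln.
      unfold Rpower.
      (* Weighted AM-GM for [r] and 1 with mean [w]: weighting the two tangent bounds by [s] and
         [1 - s] makes the right-hand sides cancel, leaving [s * ln r <= ln w]. *)
      pose proof (ln_le_sub_1 (r / w) ltac:(now apply Rdiv_lt_0_compat)) as L1.
      pose proof (ln_le_sub_1 (1 / w) ltac:(apply Rdiv_lt_0_compat; lra)) as L2.
      rewrite ln_div in L1, L2 by lra. rewrite ln_1 in L2.
      assert (E : s * (r / w - 1) + (1 - s) * (1 / w - 1) = 0)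
        by (unfold w in *; field; lra).
      assert (Hle : s * ln r <= ln w) by nra.
      destruct Hle as [Hlt | Heq]; [left; now apply exp_increasing | right; now f_equal]. }
    replace (c * (1 - s) * (A * B) + c * s / x * (A * t * B))
      with (A * B * (c * (1 - s + s * (t / x)))) by (field; lra).
    replace (A * Rpower t s * B) with (A * B * Rpower t s) by ring.
    apply Rmult_le_compat_l; lra.
Qed.

(** * Derivatives of -ln and their convexity gaps *)

(* [(-1)^n] times the [n]-th derivative of [- ln]. *)
Definition neg_ln_derive (n : nat) (z : R) : R :=
  match n with
  | O => - ln z
  | S m => INR (fact m) / z ^ S m
  end.

Lemma neg_ln_derive_S_pos (n : nat) (z : R) (hz : 0 < z) : 0 < neg_ln_derive (S n) z.
Proof. apply Rdiv_lt_0_compat; [apply INR_fact_lt_0 | now apply pow_lt]. Qed.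

Lemma is_derive_neg_ln_derive (n : nat) (z : R) (hz : 0 < z) :
  is_derive (neg_ln_derive n) z (- neg_ln_derive (S n) z).
Proof.
  destruct n as [| m].
  - unfold neg_ln_derive. auto_derive; [exact hz |]. simpl. field. lra.
  - assert (z ^ m <> 0) by (apply pow_nonzero; lra).
    unfold neg_ln_derive. auto_derive.
    + repeat split. change (z * z ^ m <> 0). apply Rmult_integral_contrapositive_currified; lra.
    + rewrite fact_simpl, mult_INR. simpl pow. simpl pred.
      change (match m with O => 1 | S _ => INR m + 1 end) with (INR (S m)). field. lra.
Qed.

Lemma antitone_of_is_derive_nonpos (f df : R -> R) (x y : R) (hxy : x <= y)
    (hf : forall t, x <= t <= y -> is_derive f t (df t))
    (hdf : forall t, x <= t <= y -> df t <= 0) : f y <= f x.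
Proof.
  destruct (MVT_gen f x y df) as [c [hc he]].
  - intros t ht. rewrite Rmin_left, Rmax_right in ht by lra. apply hf; lra.
  - intros t ht. rewrite Rmin_left, Rmax_right in ht by lra.
    apply continuity_pt_filterlim, (ex_derive_continuous (V := R_NormedModule)).
    eexists. apply hf; lra.
  - rewrite Rmin_left, Rmax_right in hc by lra. specialize (hdf c hc). nra.
Qed.

Lemma neg_ln_derive_antitone (n : nat) (x y : R) (hx : 0 < x) (hxy : x <= y) :
  neg_ln_derive n y <= neg_ln_derive n x.
Proof.
  apply antitone_of_is_derive_nonpos with (fun t => - neg_ln_derive (S n) t); [easy | |].
  - intros t ht. apply is_derive_neg_ln_derive; lra.
  - intros t ht. pose proof (neg_ln_derive_S_pos n t ltac:(lra)); lra.
Qed.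

(** Jensen's gap at [z + s = (1 - s) z + s (z + 1)]: the height of the chord over the unit interval
    above the graph. *)
Definition convexity_gap (s : R) (n : nat) (z : R) : R :=
  (1 - s) * neg_ln_derive n z + s * neg_ln_derive n (z + 1) - neg_ln_derive n (z + s).

(** The mean value theorem on either side of [z + s] writes the gap as [s (1 - s)] times the
    difference of [neg_ln_derive (S n)] at points [c <= d], and that function is antitone. *)
Lemma convexity_gap_nonneg (s : R) (n : nat) (z : R) (hs : 0 < s < 1) (hz : 0 < z) :
  0 <= convexity_gap s n z.
Proof.
  assert (hMVT : forall x y, 0 < x -> x < y -> exists c, x <= c <= y /\
    neg_ln_derive n y - neg_ln_derive n x = - neg_ln_derive (S n) c * (y - x)).
  { intros x y hx hxy.
    destruct (MVT_gen (neg_ln_derive n) x y (fun t => - neg_ln_derive (S n) t)) as [c [hc he]].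
    - intros t ht. rewrite Rmin_left, Rmax_right in ht by lra.
      apply is_derive_neg_ln_derive; lra.
    - intros t ht. rewrite Rmin_left, Rmax_right in ht by lra.
      apply continuity_pt_filterlim, (ex_derive_continuous (V := R_NormedModule)).
      eexists. apply is_derive_neg_ln_derive; lra.
    - rewrite Rmin_left, Rmax_right in hc by lra. now exists c. }
  destruct (hMVT z (z + s)) as [c [hc ec]]; [lra | lra |].
  destruct (hMVT (z + s) (z + 1)) as [d [hd ed]]; [lra | lra |].
  pose proof (neg_ln_derive_antitone (S n) c d ltac:(lra) ltac:(lra)) as hcd.
  unfold convexity_gap.
  replace (z + s - z) with s in ec by ring.
  replace (z + 1 - (z + s)) with (1 - s) in ed by ring.
  assert (0 <= s * (1 - s) * (neg_ln_derive (S n) c - neg_ln_derive (S n) d))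
    by (apply Rmult_le_pos; nra).
  nra.
Qed.

(** Monotonicity alone gives this cruder bound, chosen because it telescopes along [z], [z + 1],
    [z + 2] and so on. *)
Lemma convexity_gap_le (s : R) (n : nat) (z : R) (hs : 0 < s < 1) (hz : 0 < z) :
  convexity_gap s n z <= neg_ln_derive n z - neg_ln_derive n (z + 1).
Proof.
  unfold convexity_gap.
  pose proof (neg_ln_derive_antitone n (z + s) (z + 1) ltac:(lra) ltac:(lra)).
  pose proof (neg_ln_derive_antitone n z (z + 1) ltac:(lra) ltac:(lra)).
  nra.
Qed.

Lemma is_derive_convexity_gap (s : R) (n : nat) (c z : R)
    (hs : 0 < s < 1) (hz : 0 < z + c) :
  is_derive (fun y => convexity_gap s n (y + c)) z (- convexity_gap s (S n) (z + c)).
Proof.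
  assert (H : forall d, 0 < z + c + d ->
    is_derive (fun y => neg_ln_derive n (y + c + d)) z (- neg_ln_derive (S n) (z + c + d))).
  { intros d hd. rewrite <- (Rmult_1_l (- _)).
    apply (is_derive_comp (neg_ln_derive n) (fun y => y + c + d)).
    - now apply is_derive_neg_ln_derive.
    - auto_derive; [easy | ring]. }
  unfold convexity_gap.
  pose proof (H 0 ltac:(lra)) as H0. pose proof (H s ltac:(lra)) as Hs.
  pose proof (H 1 ltac:(lra)) as H1.
  replace (- ((1 - s) * neg_ln_derive (S n) (z + c) + s * neg_ln_derive (S n) (z + c + 1)
      - neg_ln_derive (S n) (z + c + s)))
    with ((1 - s) * - neg_ln_derive (S n) (z + c + 0) + s * - neg_ln_derive (S n) (z + c + 1)
      - - neg_ln_derive (S n) (z + c + s)) by (rewrite Rplus_0_r; ring).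
  apply (is_derive_minus (V := R_NormedModule)); [| exact Hs].
  apply (is_derive_plus (V := R_NormedModule)).
  - apply is_derive_scal. eapply is_derive_ext; [| exact H0].
    intros t; simpl. now rewrite Rplus_0_r.
  - now apply is_derive_scal.
Qed.

(** * Uniform convergence and termwise differentiation of the gap sums *)

Definition gap_sum (s : R) (n N : nat) (y : R) : R :=
  sum_n (fun k => convexity_gap s n (y + INR k)) N.

Lemma gap_sum_S (s : R) (n N : nat) (y : R) :
  gap_sum s n (S N) y = gap_sum s n N y + convexity_gap s n (y + INR (S N)).
Proof. unfold gap_sum. now rewrite sum_Sn. Qed.

Lemma is_derive_gap_sum (s : R) (n N : nat) (y : R) (hs : 0 < s < 1) (hy : 0 < y) :
  is_derive (gap_sum s n N) y (- gap_sum s (S n) N y).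
Proof.
  induction N as [| N IH].
  - unfold gap_sum.
    apply is_derive_ext with (fun y => convexity_gap s n (y + INR 0));
      [intros; now rewrite sum_O |].
    rewrite sum_O. apply is_derive_convexity_gap; simpl; lra.
  - apply is_derive_ext with
      (fun y => gap_sum s n N y + convexity_gap s n (y + INR (S N)));
      [intros; symmetry; apply gap_sum_S |].
    rewrite gap_sum_S, Ropp_plus_distr.
    apply (is_derive_plus (V := R_NormedModule)); [exact IH |].
    apply is_derive_convexity_gap; [lra |]. pose proof (pos_INR (S N)); lra.
Qed.

(** The bounds of [convexity_gap_le] telescope. As [sum_n] includes its last index, the tail begins
    at [S N]. *)
Lemma gap_sum_le (s : R) (n N M : nat) (y : R) (hs : 0 < s < 1) (hy : 0 < y)
    (hNM : (N <= M)%nat) :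
  0 <= gap_sum s n M y - gap_sum s n N y <=
    neg_ln_derive n (y + INR (S N)) - neg_ln_derive n (y + INR (S M)).
Proof.
  induction hNM as [| M hNM IH]; [lra |].
  rewrite gap_sum_S.
  pose proof (pos_INR (S M)).
  pose proof (convexity_gap_nonneg s n (y + INR (S M)) hs ltac:(lra)).
  pose proof (convexity_gap_le s n (y + INR (S M)) hs ltac:(lra)) as Hle.
  rewrite (S_INR (S M)), <- Rplus_assoc. lra.
Qed.

(* The telescoping bound of [gap_sum_le] tends to 0 only for [n >= 1], hence the
   case [n = 0] is assumed. *)
Lemma gap_sum_CVU (s : R) (n : nat) (hs : 0 < s < 1)
    (h0 : n = O -> CVU_dom (gap_sum s 0) (fun y => 0 < y)) :
  CVU_dom (gap_sum s n) (fun y => 0 < y).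
Proof.
  destruct n as [| m]; [now apply h0 |].
  apply CVU_dom_cauchy. intros eps.
  pose proof (INR_fact_lt_0 m) as hf.
  (* This [N] makes [m! / (N + 1) < eps]. It serves every [y > 0] at once, since the tail is
     evaluated at arguments at least [N + 1]. *)
  destruct (nfloor_ex (INR (fact m) / eps)) as [N [_ hN]].
  { left. apply Rdiv_lt_0_compat; [exact hf | apply cond_pos]. }
  assert (hmain : forall p q y, 0 < y -> (N <= p)%nat -> (p <= q)%nat ->
    0 <= gap_sum s (S m) q y - gap_sum s (S m) p y < eps).
  { intros p q y hy hp hpq.
    pose proof (gap_sum_le s (S m) p q y hs hy hpq) as [hl hu].
    split; [exact hl |]. eapply Rle_lt_trans; [exact hu |].
    assert (hpN : INR N + 1 <= y + INR (S p)).
    { rewrite S_INR. apply le_INR in hp. lra. }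
    pose proof (pos_INR N).
    pose proof (neg_ln_derive_S_pos m (y + INR (S q))
      ltac:(pose proof (pos_INR (S q)); lra)).
    assert (hb : neg_ln_derive (S m) (y + INR (S p)) <= INR (fact m) / (INR N + 1)).
    { unfold neg_ln_derive. apply Rmult_le_compat_l; [lra |].
      apply Rinv_le_contravar; [lra |].
      rewrite <- tech_pow_Rmult.
      assert (1 <= (y + INR (S p)) ^ m) by (apply pow_R1_Rle; lra).
      nra. }
    assert (INR (fact m) / (INR N + 1) < eps).
    { apply Rlt_div_l; [lra |]. rewrite Rmult_comm. apply Rlt_div_l; [apply cond_pos | lra]. }
    lra. }
  exists N. intros p q y hy hp hq.
  destruct (Nat.le_ge_cases p q) as [h | h].
  - rewrite Rabs_minus_sym, Rabs_right; pose proof (hmain p q y hy hp h); lra.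
  - rewrite Rabs_right; pose proof (hmain q p y hy hq h); lra.
Qed.

Definition gap_series (s : R) (n : nat) (y : R) : R :=
  real (Lim_seq (fun N => gap_sum s n N y)).

(** Differentiating the sums of order [n] gives minus those of order [S n], and both converge
    uniformly, so limit and derivative commute. Order 0 enters through [h0]. *)
Lemma is_derive_gap_series (s : R) (n : nat) (y : R) (hs : 0 < s < 1) (hy : 0 < y)
    (h0 : CVU_dom (gap_sum s 0) (fun y => 0 < y)) :
  is_derive (gap_series s n) y (- gap_series s (S n) y).
Proof.
  assert (hD : forall N t, 0 < t -> Derive (gap_sum s n N) t = - gap_sum s (S n) N t).
  { intros N t ht. now apply is_derive_unique, is_derive_gap_sum. }
  assert (hL : forall t, 0 < t -> real (Lim_seq (fun N => Derive (gap_sum s n N) t))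
     = - gap_series s (S n) t).
  { intros t ht. rewrite (Lim_seq_ext _ (fun N => - gap_sum s (S n) N t))
      by (intros; now apply hD).
    rewrite Lim_seq_opp. apply Rbar_opp_real. }
  rewrite <- hL by exact hy.
  apply (CVU_Derive (gap_sum s n) (fun t => 0 < t)); try easy.
  - apply open_gt.
  - intros a b x ha hb hx. lra.
  - apply gap_sum_CVU; [exact hs | now intros ->].
  - intros N t ht. eexists. now apply is_derive_gap_sum.
  - intros N t ht. apply (continuity_pt_ext_loc (fun t => - gap_sum s (S n) N t)).
    + exists (mkposreal t ht). intros u hu. symmetry. apply hD.
      apply Rabs_lt_between in hu. unfold minus, plus, opp in hu; simpl in hu. lra.
    + apply continuity_pt_filterlim.
      apply (ex_derive_continuous (V := R_NormedModule) (fun t => - gap_sum s (S n) N t)).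
      apply (ex_derive_opp (V := R_NormedModule) (gap_sum s (S n) N)).
      eexists. now apply is_derive_gap_sum.
  - intros eps.
    pose proof (gap_sum_CVU s (S n) hs ltac:(easy) eps) as HC.
    eapply filter_imp; [| exact HC]. intros N HN t ht.
    rewrite hL, hD by exact ht. specialize (HN t ht).
    unfold gap_series. rewrite <- Rabs_Ropp.
    match goal with |- Rabs ?u < _ => match type of HN with Rabs ?v < _ =>
      replace u with v by ring end end.
    exact HN.
Qed.

Lemma gap_series_nonneg (s : R) (n : nat) (y : R) (hs : 0 < s < 1) (hy : 0 < y) :
  0 <= gap_series s n y.
Proof.
  assert (h : Rbar_le 0 (Lim_seq (fun N => gap_sum s n N y))).
  { rewrite <- (Lim_seq_const 0). apply Lim_seq_le_loc. exists 0%nat. intros N _.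
    pose proof (gap_sum_le s n 0 N y hs hy (Nat.le_0_l N)) as [h _].
    assert (0 <= gap_sum s n 0 y).
    { unfold gap_sum. rewrite sum_O. apply convexity_gap_nonneg; simpl; lra. }
    lra. }
  (* [real] sends infinite limits to 0, so the sign holds in every case without a finiteness
     argument. *)
  unfold gap_series. destruct (Lim_seq _); simpl in *; lra.
Qed.

(** * The gap series of order zero as the logarithm of a Gamma ratio *)

Definition log_gamma_ratio (s y : R) : R := ln (Gamma y) - ln (Gamma (y + s)) + s * ln y.

Lemma Gamma_pos (x : R) (hx : 0 < x) : 0 < Gamma x.
Proof. now apply Gamma_correct. Qed.

Lemma ln_Gamma_succ (x : R) (hx : 0 < x) : ln (Gamma (x + 1)) = ln x + ln (Gamma x).
Proof. rewrite Gamma_succ, ln_mult; auto using Gamma_pos. Qed.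

Lemma ln_Gamma_add_le (x s : R) (hx : 0 < x) (hs : 0 < s < 1) :
  ln (Gamma (x + s)) <= s * ln x + ln (Gamma x).
Proof.
  rewrite <- ln_Rpower, <- ln_mult; [| apply exp_pos | now apply Gamma_pos].
  apply ln_le; [apply Gamma_pos; lra | now apply Gamma_add_le].
Qed.

(** The lower bound is the step from [y] to [y + s]. For the upper one, the step from [y + s] to
    [y + 1] and the functional equation give [(1 - s) (ln (y + s) - ln y)], which is at most
    [(1 - s) s / y]. *)
Lemma log_gamma_ratio_bounds (s y : R) (hs : 0 < s < 1) (hy : 0 < y) :
  0 <= log_gamma_ratio s y <= / y.
Proof.
  unfold log_gamma_ratio.
  pose proof (ln_Gamma_add_le y s hy hs) as H0.
  pose proof (ln_Gamma_add_le (y + s) (1 - s) ltac:(lra) ltac:(lra)) as H1.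
  replace (y + s + (1 - s)) with (y + 1) in H1 by ring.
  rewrite ln_Gamma_succ in H1 by exact hy.
  pose proof (ln_le_sub_1 ((y + s) / y) ltac:(apply Rdiv_lt_0_compat; lra)) as H2.
  rewrite ln_div in H2 by lra.
  replace ((y + s) / y - 1) with (s * / y) in H2 by (field; lra).
  pose proof (Rinv_0_lt_compat y hy).
  split; [lra |].
  assert ((1 - s) * (ln (y + s) - ln y) <= (1 - s) * (s * / y))
    by (apply Rmult_le_compat_l; lra).
  assert (0 <= (1 - (1 - s) * s) * / y) by (apply Rmult_le_pos; nra).
  nra.
Qed.

Lemma log_gamma_ratio_succ (s y : R) (hs : 0 < s < 1) (hy : 0 < y) :
  log_gamma_ratio s y = convexity_gap s 0 y + log_gamma_ratio s (y + 1).
Proof.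
  unfold log_gamma_ratio, convexity_gap, neg_ln_derive.
  replace (y + 1 + s) with (y + s + 1) by ring.
  rewrite !ln_Gamma_succ by lra. ring.
Qed.

Lemma gap_sum_0_eq (s : R) (N : nat) (y : R) (hs : 0 < s < 1) (hy : 0 < y) :
  gap_sum s 0 N y = log_gamma_ratio s y - log_gamma_ratio s (y + INR (S N)).
Proof.
  induction N as [| N IH].
  - unfold gap_sum. rewrite sum_O. simpl. rewrite Rplus_0_r.
    rewrite (log_gamma_ratio_succ s y) by easy. ring.
  - rewrite gap_sum_S, IH. pose proof (pos_INR (S N)).
    rewrite (log_gamma_ratio_succ s (y + INR (S N))) by lra.
    rewrite (S_INR (S N)), <- Rplus_assoc. ring.
Qed.

(** The remainder is [log_gamma_ratio] at [y + n + 1], at most [1 / (y + n + 1)] and hence small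
    uniformly in [y > 0]. This supplies the order-zero case assumed in [gap_sum_CVU]. *)
Lemma gap_sum_0_uniform (s : R) (eps : posreal) (hs : 0 < s < 1) :
  eventually (fun N => forall y, 0 < y -> Rabs (gap_sum s 0 N y - log_gamma_ratio s y) < eps).
Proof.
  destruct (nfloor_ex (/ eps)) as [N [_ hN]].
  { left. apply Rinv_0_lt_compat, cond_pos. }
  exists N. intros n hn y hy. apply le_INR in hn. pose proof (pos_INR N).
  rewrite gap_sum_0_eq by easy. rewrite S_INR.
  destruct (log_gamma_ratio_bounds s (y + (INR n + 1)) hs ltac:(lra)) as [hl hu].
  replace (_ - _ - _) with (- log_gamma_ratio s (y + (INR n + 1))) by ring.
  rewrite Rabs_Ropp, Rabs_right by lra.
  eapply Rle_lt_trans; [exact hu |].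
  rewrite <- (Rinv_inv eps).
  apply Rinv_lt_contravar; [| lra].
  apply Rmult_lt_0_compat; [apply Rinv_0_lt_compat, cond_pos | lra].
Qed.

Lemma gap_series_0 (s y : R) (hs : 0 < s < 1) (hy : 0 < y) :
  gap_series s 0 y = log_gamma_ratio s y.
Proof.
  unfold gap_series.
  rewrite (is_lim_seq_unique _ (log_gamma_ratio s y)); [reflexivity |].
  apply is_lim_seq_spec. intros eps.
  eapply filter_imp; [| exact (gap_sum_0_uniform s eps hs)].
  intros N HN. now apply HN.
Qed.

Lemma gap_sum_0_CVU (s : R) (hs : 0 < s < 1) : CVU_dom (gap_sum s 0) (fun y => 0 < y).
Proof.
  intros eps. eapply filter_imp; [| exact (gap_sum_0_uniform s eps hs)].
  intros N HN y hy. change (real (Lim_seq _)) with (gap_series s 0 y).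
  rewrite gap_series_0 by easy. now apply HN.
Qed.

(** * Existence of higher derivatives on a half-line *)

(** Each derivative is a witness constrained only on the half-line, so sums and products are handled
    by plain induction, without formulas for [Derive_n]. *)
Fixpoint derivable_upto (l : R) (n : nat) (f : R -> R) : Prop :=
  match n with
  | O => True
  | S m => exists df, (forall x, l < x -> is_derive f x (df x)) /\ derivable_upto l m df
  end.

Lemma locally_gt (l x : R) (hx : l < x) : locally x (fun t => l < t).
Proof. now apply open_gt. Qed.

Lemma derivable_upto_ex_derive_n (l : R) (n : nat) (f : R -> R) (x : R)
    (hf : derivable_upto l n f) (hx : l < x) : ex_derive_n f n x.
Proof.
  revert f x hf hx. induction n as [| n IH]; [easy |].
  intros f x [df [hdf hn]] hx. destruct n as [| k]; [now exists (df x); apply hdf |].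
  (* Near [x], the derivative of order [k + 1] of [f] is the one of order [k] of [df], to which the
     induction hypothesis applies. *)
  apply (ex_derive_ext_loc (Derive_n df k)); [| now apply (IH df)].
  eapply filter_imp; [| exact (locally_gt l x hx)]. intros t ht.
  rewrite <- Nat.add_1_r, <- Derive_n_comp.
  apply Derive_n_ext_loc. eapply filter_imp; [| exact (locally_gt l t ht)].
  intros u hu. symmetry. now apply is_derive_unique, hdf.
Qed.

Lemma derivable_upto_pred (l : R) (n : nat) (f : R -> R) :
  derivable_upto l (S n) f -> derivable_upto l n f.
Proof.
  revert f. induction n as [| n IH]; [easy |].
  intros f [df [hdf hn]]. exists df. split; [exact hdf | now apply IH].
Qed.

Lemma derivable_upto_plus (l : R) (n : nat) (f g : R -> R) :
  derivable_upto l n f -> derivable_upto l n g ->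
  derivable_upto l n (fun x => f x + g x).
Proof.
  revert f g. induction n as [| n IH]; [easy |].
  intros f g [df [hdf hf]] [dg [hdg hg]].
  exists (fun x => df x + dg x). split; [| now apply IH].
  intros x hx. apply (is_derive_plus (V := R_NormedModule)); auto.
Qed.

Lemma derivable_upto_mult (l : R) (n : nat) (f g : R -> R) :
  derivable_upto l n f -> derivable_upto l n g ->
  derivable_upto l n (fun x => f x * g x).
Proof.
  revert f g. induction n as [| n IH]; [easy |].
  intros f g Hf Hg.
  pose proof (derivable_upto_pred _ _ _ Hf). pose proof (derivable_upto_pred _ _ _ Hg).
  destruct Hf as [df [hdf hf]], Hg as [dg [hdg hg]].
  exists (fun x => df x * g x + f x * dg x). split.
  - intros x hx. apply (is_derive_mult f g); auto. intros; apply Rmult_comm.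
  - now apply derivable_upto_plus; apply IH.
Qed.

(** Bootstrapping: if [f] has [n] derivatives, so has [f' = g f], hence [f] has one more. Applied to
    [g = (ln f)'], it carries smoothness from the logarithmic derivative to [f]. *)
Lemma derivable_upto_linear_ode (l : R) (n : nat) (f g : R -> R)
    (hfg : forall x, l < x -> is_derive f x (g x * f x))
    (hg : forall m, derivable_upto l m g) : derivable_upto l n f.
Proof.
  induction n as [| n IH]; [easy |].
  exists (fun x => g x * f x). split; [exact hfg | now apply derivable_upto_mult].
Qed.

(** * Signs of the logarithmic derivatives and the equivalence *)

(* [(-1)^n] times the [n]-th derivative of
   [beta * ln y + ln (Gamma y) - ln (Gamma (y + s))]. *)
Definition log_derive (s beta : R) (n : nat) (y : R) : R :=
  gap_series s n y + (s - beta) * neg_ln_derive n y.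

Lemma is_derive_log_derive (s beta a : R) (n : nat) (x : R)
    (hs : 0 < s < 1) (hx : - a < x) :
  is_derive (fun t => log_derive s beta n (t + a)) x (- log_derive s beta (S n) (x + a)).
Proof.
  rewrite <- (Rmult_1_l (- _)).
  apply (is_derive_comp (log_derive s beta n) (fun t => t + a)).
  - replace (- log_derive s beta (S n) (x + a)) with
      (- gap_series s (S n) (x + a) + (s - beta) * - neg_ln_derive (S n) (x + a))
      by (unfold log_derive; ring).
    apply (is_derive_plus (V := R_NormedModule)).
    + apply is_derive_gap_series; [exact hs | lra | now apply gap_sum_0_CVU].
    + apply is_derive_scal, is_derive_neg_ln_derive. lra.
  - auto_derive; [easy | ring].
Qed.

(** The factor [c] absorbs the sign change of each differentiation, so that the induction closes. *)
Lemma derivable_upto_log_derive (s beta a c : R) (n k : nat) (hs : 0 < s < 1) :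
  derivable_upto (- a) n (fun x => c * log_derive s beta k (x + a)).
Proof.
  revert c k. induction n as [| n IH]; [easy |]. intros c k.
  exists (fun x => - c * log_derive s beta (S k) (x + a)). split; [| apply IH].
  intros x hx.
  replace (- c * log_derive s beta (S k) (x + a))
    with (c * - log_derive s beta (S k) (x + a)) by ring.
  now apply is_derive_scal, is_derive_log_derive.
Qed.

Lemma beta_le_of_log_derive_nonneg (s beta : R) (hs : 0 < s < 1)
    (h : forall y, 0 < y -> 0 <= log_derive s beta 1 y) : beta <= s.
Proof.
  apply Rnot_lt_le. intros hlt.
  set (C := log_derive s beta 0 1).
  (* Chosen so that [(beta - s) ln y = |C| + (beta - s)], which exceeds [C]; monotonicity from 1 to
     [y] and the nonnegative gap series would force it to be at most [C]. *)
  set (y := exp (Rabs C / (beta - s) + 1)).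
  assert (hC : 0 <= Rabs C / (beta - s)) by (apply Rdiv_le_0_compat; [apply Rabs_pos | lra]).
  assert (hy : 1 <= y).
  { unfold y. pose proof (exp_ineq1_le (Rabs C / (beta - s) + 1)). lra. }
  assert (hle : log_derive s beta 0 y <= C).
  { apply antitone_of_is_derive_nonpos with (fun t => - log_derive s beta 1 t); [easy | |].
    - intros t ht.
      pose proof (is_derive_log_derive s beta 0 0 t hs ltac:(lra)) as H.
      rewrite Rplus_0_r in H. eapply is_derive_ext; [| exact H].
      intros u; simpl. now rewrite Rplus_0_r.
    - intros t ht. specialize (h t ltac:(lra)). lra. }
  unfold log_derive in hle.
  pose proof (gap_series_nonneg s 0 y hs ltac:(lra)) as hg.
  assert (E : (s - beta) * neg_ln_derive 0 y = Rabs C + (beta - s)).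
  { unfold neg_ln_derive, y. rewrite ln_exp. field. lra. }
  pose proof (Rle_abs C). lra.
Qed.

Theorem theorem2p19 (a b : R) (ha : 0 <= a) (hb : 0 < b)
    (hab : 0 < 1 - b + a < 1) (beta : R) :
  log_completely_monotone (Finite (- a)) p_infty
    (fun x : R => Rpower (x + a) beta * Gamma (x + a) / Gamma (x + b))
  <-> beta <= b - a.
Proof.
  set (s := b - a). set (f := fun x : R => _).
  assert (hs : 0 < s < 1) by (unfold s; lra).
  assert (hln : forall x, - a < x -> ln (f x) = log_derive s beta 0 (x + a)).
  { intros x hx. unfold f, log_derive.
    replace (x + b) with (x + a + s) by (unfold s; ring).
    rewrite gap_series_0 by lra. unfold log_gamma_ratio, neg_ln_derive.
    assert (0 < Gamma (x + a)) by (apply Gamma_pos; lra).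
    assert (0 < Gamma (x + a + s)) by (apply Gamma_pos; lra).
    rewrite ln_div, ln_mult, ln_Rpower; try easy; try apply exp_pos; [ring |].
    apply Rmult_lt_0_compat; [apply exp_pos | easy]. }
  assert (hpos : forall x, - a < x -> 0 < f x).
  { intros x hx. unfold f. apply Rdiv_lt_0_compat; [apply Rmult_lt_0_compat |].
    - apply exp_pos.
    - apply Gamma_pos; lra.
    - apply Gamma_pos; unfold s in hs; lra. }
  assert (hder : forall n x, - a < x ->
    Derive_n (fun y => ln (f y)) n x = (-1) ^ n * log_derive s beta n (x + a)).
  { induction n as [| n IH]; intros x hx.
    - simpl. rewrite hln by exact hx. ring.
    - simpl Derive_n.
      (* The formula of order [n] is known only to the right of [- a], so it is used on a
         neighbourhood of [x]. *)
      rewrite (Derive_ext_loc _ (fun t => (-1) ^ n * log_derive s beta n (t + a))).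
      + apply is_derive_unique.
        replace ((-1) ^ S n * log_derive s beta (S n) (x + a))
          with ((-1) ^ n * - log_derive s beta (S n) (x + a)) by (simpl; ring).
        now apply is_derive_scal, is_derive_log_derive.
      + eapply filter_imp; [| exact (locally_gt _ x hx)]. exact IH. }
  assert (hsign : forall n x, - a < x ->
    (-1) ^ n * Derive_n (fun y => ln (f y)) n x = log_derive s beta n (x + a)).
  { intros n x hx. rewrite hder by exact hx. rewrite <- Rmult_assoc, <- Rpow_mult_distr.
    replace (-1 * -1) with 1 by ring. rewrite pow1. ring. }
  split.
  - intros (_ & _ & hmono). apply beta_le_of_log_derive_nonneg; [exact hs |].
    (* The first derivative suffices for necessity; [x = y - a] undoes the shift. *)
    intros y hy. specialize (hmono 1%nat (y - a) (le_n 1)).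
    rewrite hsign in hmono by lra. replace (y - a + a) with y in hmono by ring.
    apply hmono; simpl; [lra | easy].
  - intros hbeta. split; [| split].
    + intros x hx _. now apply hpos.
    + intros n x hx _. apply (derivable_upto_ex_derive_n (- a)); [| exact hx].
      apply (derivable_upto_linear_ode _ _ _ (fun x => -1 * log_derive s beta 1 (x + a))).
      * intros t ht.
        apply (is_derive_ext_loc (fun t => exp (log_derive s beta 0 (t + a)))).
        -- eapply filter_imp; [| exact (locally_gt _ t ht)]. intros u hu.
           rewrite <- hln by exact hu. now apply exp_ln, hpos.
        -- rewrite <- (exp_ln (f t)) by now apply hpos. rewrite hln by exact ht.
           replace (-1 * log_derive s beta 1 (t + a)) with (- log_derive s beta 1 (t + a)) by ring.
           apply (is_derive_comp exp (fun t => log_derive s beta 0 (t + a))).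
           ++ apply is_derive_Reals, derivable_pt_lim_exp.
           ++ now apply is_derive_log_derive.
      * intros m. now apply derivable_upto_log_derive.
    + intros n x hn hx _. rewrite hsign by exact hx. simpl in hx.
      (* Order 0 is excluded because [- ln] has no constant sign; from order 1 on, both summands of
         [log_derive] are nonnegative. *)
      destruct n as [| m]; [inversion hn |]. unfold log_derive.
      pose proof (gap_series_nonneg s (S m) (x + a) hs ltac:(lra)).
      pose proof (neg_ln_derive_S_pos m (x + a) ltac:(lra)).
      assert (0 <= (s - beta) * neg_ln_derive (S m) (x + a)) by (apply Rmult_le_pos; lra).
      lra.
Qed.
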